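(* One has the equivalence $$S_{\mathrm{BBG}} = \mathrm{Ei}(\log 3) \iff R = \mathrm{Ei}(\log 3)-\log 6,$$ where $\mathrm{Ei}(\log 3)-\log 6\approx 0.371829125439\ldots$
   Context: $S_{\mathrm{BBG}} := \sum_{n=1}^{\infty}\frac1n\left(\frac{2+\sin n}{3}\right)^{n}$ (sine of the integer $n$ in radians). For $n\ge 0$, $I_n := \frac{1}{2\pi}\int_0^{2\pi}\left(\frac{2+\sin\theta}{3}\right)^{n}d\theta$, and $$R := \sum_{n=1}^{\infty}\frac{1}{n}\left[\left(\frac{2+\sin n}{3}\right)^{n}-I_n\right].$$ For $t>0$, the exponential integral is $$\mathrm{Ei}(t) = \mathrm{P.V.}\int_{-\infty}^{t}\frac{e^u}{u}\,du = \gamma+\log t+\sum_{n=1}^{\infty}\frac{t^n}{n\cdot n!},$$ where $\gamma$ is the Euler--Mascheroni constant. *)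

(* Defs.v *)
From Stdlib Require Import Reals.
From Coquelicot Require Import Coquelicot.
Open Scope R_scope.

(* [sum_from_one u s]: the series of the [u n] over [n >= 1] converges, with
   sum [s].  A relation rather than Coquelicot's total [Series], which takes an
   arbitrary value on divergent series. *)
Definition sum_from_one (u : nat -> R) (s : R) : Prop :=
  is_series (fun k => u (S k)) s.

Definition bbg_term (n : nat) : R :=
  / INR n * ((2 + sin (INR n)) / 3) ^ n.

Definition I_mean (n : nat) : R :=
  / (2 * PI) * RInt (fun theta => ((2 + sin theta) / 3) ^ n) 0 (2 * PI).

Definition R_term (n : nat) : R :=
  / INR n * (((2 + sin (INR n)) / 3) ^ n - I_mean n).

Definition is_S_BBG (s : R) : Prop := sum_from_one bbg_term s.

Definition is_R (r : R) : Prop := sum_from_one R_term r.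

(* Integral of exp u / u over (-oo, t] with the interval (-eps, eps) removed. *)
Definition Ei_cut (t eps : R) : R :=
  RInt_gen (fun u => exp u / u) (Rbar_locally m_infty) (at_point (- eps))
  + RInt (fun u => exp u / u) eps t.

(* Cauchy principal value at 0; meaningful for t > 0. *)
Definition Ei (t : R) : R :=
  iota (fun l : R => filterlim (Ei_cut t) (at_right 0) (locally l)).

(* Main.v *)
Require Import Defs.
From Stdlib Require Import Reals Factorial QArith Qreals Lra Lia.
From Coquelicot Require Import Coquelicot.
Open Scope R_scope.

(** The equivalence holds because the two series differ term by term by
    [I_n / n], and the series of the [I_n / n] converges to [ln 6]
    ([I_mean_log_sum]).  Formally this sum is the mean over a period of
    [- ln (1 - x)] with [x = (2 + sin theta) / 3], that is, of
    [ln 3 - ln (1 - sin theta)].  The integrand is singular where [sin theta = 1],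
    so the interchange of sum and integral is done below the singularity, for
    [r x] with [r < 1], where the logarithm series converges uniformly.  With
    [r = 6 rho / (1 + 4 rho + rho^2)] the argument factors as
    [1 - r x = (1 - 2 rho sin theta + rho^2) / (1 + 4 rho + rho^2)], and the
    numerator has vanishing logarithmic mean for [rho < 1]
    ([jensen_integral_zero]).  Hence the Abel sums of the series equal
    [ln (1 + 4 rho + rho^2)], which tends to [ln 6] as [rho] tends to 1; since the
    terms are nonnegative, the series itself has that sum
    ([is_series_of_abel_nonneg]).

    For the numerical value, [ln |x| + ein x], where [ein] is the entire function
    given by the series of [x^n / (n n!)], is a primitive of [exp x / x] on both
    half-lines.  It has a finite limit [L] at minus infinity, and its logarithmic
    singularity cancels in the principal value, so that
    [Ei t = ln t + ein t - L] ([Ei_eq]); the constant [L] is minus the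
    Euler-Mascheroni constant.  It is enclosed by evaluating the primitive at
    [-32], the remaining integral being at most [exp (-32) / 32]
    ([expint_prim_lim_m_infty]).  What is left is finitely many values of [exp] and
    [ein] at rational points, each enclosed by a Taylor polynomial in exact
    rational arithmetic ([taylor_enclosure]). *)

(** * Integrals over a period *)

Lemma RInt_affine (f : R -> R) (u v a b : R) :
  (forall x, continuous f x) ->
  u * RInt (fun y => f (u * y + v)) a b = RInt f (u * a + v) (u * b + v).
Proof.
intros Cf.
rewrite <- (RInt_comp_lin (V := R_CompleteNormedModule)).
- symmetry. apply (RInt_scal (V := R_CompleteNormedModule)).
  apply (ex_RInt_continuous (V := R_CompleteNormedModule)). intros z _.
  apply (continuous_comp (fun y => u * y + v) f); [|apply Cf].
  apply (ex_derive_continuous (fun y => u * y + v)). auto_derive. easy.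
- apply (ex_RInt_continuous (V := R_CompleteNormedModule)). intros z _. apply Cf.
Qed.

Lemma RInt_periodic (f : R -> R) (T c : R) :
  (forall x, continuous f x) -> (forall x, f (x + T) = f x) ->
  RInt f c (c + T) = RInt f 0 T.
Proof.
intros Cf Pf.
assert (If : forall a b, ex_RInt f a b).
{ intros a b. apply (ex_RInt_continuous (V := R_CompleteNormedModule)). intros z _. apply Cf. }
assert (Hs : RInt f T (c + T) = RInt f 0 c).
{ transitivity (1 * RInt (fun y => f (1 * y + T)) 0 c).
  - rewrite RInt_affine by exact Cf. f_equal; ring.
  - rewrite Rmult_1_l. apply RInt_ext. intros x _. now rewrite Rmult_1_l, Pf. }
rewrite <- (RInt_Chasles f c 0 (c + T)) by apply If.
rewrite <- (RInt_Chasles f 0 T (c + T)) by apply If.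
rewrite Hs, <- (opp_RInt_swap f 0 c) by apply If.
unfold plus, opp; simpl. ring.
Qed.

(** * Vanishing of the mean of ln |1 - rho z|^2 *)

Definition jensen_integrand (rho theta : R) : R :=
  ln (1 - 2 * rho * sin theta + rho ^ 2).

(** Up to the factor [2 PI], the mean of [ln |1 - rho z|^2] over the unit circle. *)
Definition jensen_integral (rho : R) : R := RInt (jensen_integrand rho) 0 (2 * PI).

Lemma jensen_arg_bounds (rho theta : R) :
  -1 < rho < 1 -> 0 < 1 - 2 * rho * sin theta + rho ^ 2.
Proof.
intros H. generalize (SIN_bound theta). intros B.
destruct (Rle_dec 0 rho); nra.
Qed.

Lemma jensen_integrand_cont (rho theta : R) :
  -1 < rho < 1 -> continuous (jensen_integrand rho) theta.
Proof.
intros H. apply (ex_derive_continuous (jensen_integrand rho)).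
unfold jensen_integrand. auto_derive.
generalize (jensen_arg_bounds rho theta H). simpl. intros; lra.
Qed.

Lemma jensen_integrand_int (rho a b : R) :
  -1 < rho < 1 -> ex_RInt (jensen_integrand rho) a b.
Proof.
intros H. apply (ex_RInt_continuous (V := R_CompleteNormedModule)).
intros z _. now apply jensen_integrand_cont.
Qed.

Lemma jensen_integral_period (rho c : R) :
  -1 < rho < 1 -> RInt (jensen_integrand rho) c (c + 2 * PI) = jensen_integral rho.
Proof.
intros H. apply RInt_periodic.
- intros x. now apply jensen_integrand_cont.
- intros x. unfold jensen_integrand. f_equal.
  replace (sin (x + 2 * PI)) with (sin x); [ring|].
  rewrite <- (sin_period x 1). f_equal. simpl. ring.
Qed.

Lemma jensen_integral_opp (rho : R) :
  -1 < rho < 1 -> jensen_integral (- rho) = jensen_integral rho.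
Proof.
intros H.
rewrite <- (jensen_integral_period rho PI H).
transitivity (1 * RInt (fun y => jensen_integrand rho (1 * y + PI)) 0 (2 * PI)).
- rewrite Rmult_1_l. apply RInt_ext. intros x _. unfold jensen_integrand.
  rewrite Rmult_1_l, neg_sin. f_equal. ring.
- rewrite RInt_affine by (intros x; now apply jensen_integrand_cont).
  f_equal; ring.
Qed.

(** The factors at [rho] and [- rho] multiply to
    [1 + rho^4 + 2 rho^2 cos (2 theta)], which is the factor at [rho^2] read at
    angle [2 theta - PI / 2]; doubling the angle runs through two periods. *)
Lemma jensen_integral_double (rho : R) :
  0 <= rho < 1 -> 2 * jensen_integral rho = jensen_integral (rho ^ 2).
Proof.
intros H.
assert (H1 : -1 < rho < 1) by lra.
assert (H1' : -1 < - rho < 1) by lra.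
assert (H2 : -1 < rho ^ 2 < 1) by (simpl; nra).
replace (2 * jensen_integral rho)
  with (jensen_integral rho + jensen_integral (- rho))
  by (rewrite jensen_integral_opp by assumption; ring).
unfold jensen_integral at 1 2.
rewrite <- (RInt_plus (V := R_CompleteNormedModule)) by now apply jensen_integrand_int.
apply Rmult_eq_reg_l with 2; [|lra].
transitivity (2 * RInt (fun y => jensen_integrand (rho ^ 2) (2 * y + - (PI / 2))) 0 (2 * PI)).
- f_equal. apply RInt_ext. intros x _. unfold plus; simpl. unfold jensen_integrand.
  rewrite <- ln_mult by now apply jensen_arg_bounds.
  f_equal.
  replace (2 * x + - (PI / 2)) with (- (PI / 2 - 2 * x)) by ring.
  rewrite sin_neg, sin_shift, cos_2a_sin. ring.
- rewrite RInt_affine by (intros x; now apply jensen_integrand_cont).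
  rewrite <- (RInt_Chasles (jensen_integrand (rho ^ 2)) _ (- (PI / 2) + 2 * PI))
    by now apply jensen_integrand_int.
  replace (2 * 0 + - (PI / 2)) with (- (PI / 2)) by ring.
  replace (2 * (2 * PI) + - (PI / 2)) with ((- (PI / 2) + 2 * PI) + 2 * PI) by ring.
  rewrite !jensen_integral_period by assumption.
  unfold plus; simpl. ring.
Qed.

Lemma jensen_integral_bound (rho sigma : R) :
  0 <= sigma <= rho -> rho < 1 ->
  Rabs (jensen_integral sigma) <= 2 * PI * (ln 4 - 2 * ln (1 - rho)).
Proof.
intros Hs Hr.
assert (H1 : -1 < sigma < 1) by lra.
assert (P := PI_RGT_0).
apply Rle_trans with ((2 * PI - 0) * (ln 4 - 2 * ln (1 - rho))); [|lra].
apply (abs_RInt_le_const (jensen_integrand sigma) 0 (2 * PI));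
  [lra | now apply jensen_integrand_int |].
intros t _. unfold jensen_integrand.
assert (Hp := jensen_arg_bounds sigma t H1).
assert (B := SIN_bound t).
assert (L4 : 0 < ln 4) by (rewrite <- ln_1; apply ln_increasing; lra).
assert (L1 : ln (1 - rho) <= 0) by (rewrite <- ln_1; apply ln_le; lra).
apply Rabs_le. split.
- apply Rle_trans with (2 * ln (1 - rho)); [lra|].
  replace (2 * ln (1 - rho)) with (ln ((1 - rho) * (1 - rho)))
    by (rewrite ln_mult by lra; ring).
  apply ln_le; nra.
- apply Rle_trans with (ln 4); [|lra].
  apply ln_le; nra.
Qed.

(** Iterating the doubling relation, [jensen_integral rho] is [2^-n] times the value
    at [rho^(2^n)], and these values stay bounded. *)
Lemma jensen_integral_zero (rho : R) : 0 <= rho < 1 -> jensen_integral rho = 0.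
Proof.
intros H.
set (C := 2 * PI * (ln 4 - 2 * ln (1 - rho))).
assert (Hn : forall n, exists sigma, 0 <= sigma <= rho /\
          jensen_integral rho = (1 / 2) ^ n * jensen_integral sigma).
{ induction n as [|n [s [Hs IH]]].
  - exists rho. split; [lra | simpl; ring].
  - exists (s ^ 2). split; [simpl; nra|].
    rewrite IH, <- jensen_integral_double by lra. simpl. field. }
assert (HC : is_lim_seq (fun n => (1 / 2) ^ n * C) 0).
{ replace (Finite 0) with (Rbar_mult 0 C) by (simpl; f_equal; ring).
  apply is_lim_seq_scal_r, is_lim_seq_geom. rewrite Rabs_pos_eq; lra. }
apply Rabs_eq_0, Rle_antisym; [|apply Rabs_pos].
apply (is_lim_seq_le (fun _ => Rabs (jensen_integral rho)) (fun n => (1 / 2) ^ n * C)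
         (Rabs (jensen_integral rho)) 0); [|apply is_lim_seq_const|exact HC].
intros n. destruct (Hn n) as [s [Hs ->]].
assert (0 < (1 / 2) ^ n) by (apply pow_lt; lra).
rewrite Rabs_mult, (Rabs_pos_eq ((1/2)^n)) by lra.
apply Rmult_le_compat_l; [lra|]. apply jensen_integral_bound; lra.
Qed.

(** * The series of I_n / n *)

(** The remainder of the logarithm series vanishes at 0 and has derivative
    [y^(N+1) / (1 - y)].  The bound depends on [r] only, which gives the uniformity
    needed to integrate the series term by term. *)
Lemma log_taylor_bound (y r : R) (N : nat) :
  0 <= y <= r -> r < 1 ->
  Rabs (- ln (1 - y) - sum_n (fun k => / INR (S k) * y ^ S k) N) <= r ^ S N / (1 - r).
Proof.
intros Hy Hr.
set (D := fun M z => - ln (1 - z) - sum_n (fun k => / INR (S k) * z ^ S k) M).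
assert (HD : forall M z, z < 1 -> is_derive (D M) z (z ^ S M / (1 - z))).
{ intros M z Hz. induction M as [|M IH].
  - apply is_derive_ext with (fun z => - ln (1 - z) - z).
    + intros t. unfold D. rewrite sum_O. cbn -[ln]. change (@eq R (- ln (1 - t) - t) (- ln (1 - t) - / 1 * (t * 1))). field.
    + auto_derive; [lra |]. field; lra.
  - apply is_derive_ext with (fun z => D M z - / INR (S (S M)) * z ^ S (S M)).
    + intros t. unfold D. rewrite sum_Sn. unfold plus; simpl. ring.
    + replace (z ^ S (S M) / (1 - z)) with
        (z ^ S M / (1 - z) - / INR (S (S M)) * (INR (S (S M)) * z ^ S M)).
      * apply (is_derive_minus (D M)); [exact IH|].
        apply is_derive_scal.
        evar_last; [apply (is_derive_pow (fun z => z)), is_derive_id|].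
        unfold one; simpl. ring.
      * rewrite <- Rmult_assoc, Rinv_l by (apply not_0_INR; lia). simpl. field. lra. }
assert (D0 : D N 0 = 0).
{ unfold D. rewrite Rminus_0_r, ln_1.
  rewrite (sum_n_ext _ (fun _ => 0)).
  - rewrite sum_n_const. ring.
  - intros n. rewrite pow_i by lia. apply Rmult_0_r. }
fold (D N y).
destruct (MVT_gen (D N) 0 y (fun z => z ^ S N / (1 - z))) as [c [Hc Hm]].
- intros x Hx. rewrite Rmax_right in Hx by lra. apply HD; lra.
- intros x Hx. rewrite Rmax_right in Hx by lra.
  apply derivable_continuous_pt. exists (x ^ S N / (1 - x)). apply is_derive_Reals, HD; lra.
- rewrite Rmin_left, Rmax_right in Hc by lra.
  rewrite D0, !Rminus_0_r in Hm. rewrite Hm.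
  assert (0 <= c ^ S N <= r ^ S N).
  { split; [apply pow_le; lra | apply pow_incr; lra]. }
  assert (0 < / (1 - c) <= / (1 - r)).
  { split; [apply Rinv_0_lt_compat; lra | apply Rinv_le_contravar; lra]. }
  unfold Rdiv.
  assert (0 <= c ^ S N * / (1 - c)) by (apply Rmult_le_pos; lra).
  rewrite Rabs_pos_eq by (apply Rmult_le_pos; lra).
  rewrite <- (Rmult_1_r (r ^ S N * / (1 - r))).
  apply Rmult_le_compat; try lra.
  apply Rmult_le_compat; lra.
Qed.

Definition base (theta : R) : R := (2 + sin theta) / 3.

Lemma base_bounds (theta : R) : 0 <= base theta <= 1.
Proof. unfold base. generalize (SIN_bound theta). lra. Qed.

Lemma base_pow_int (n : nat) (a b : R) : ex_RInt (fun t => base t ^ n) a b.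
Proof.
apply (ex_RInt_continuous (V := R_CompleteNormedModule)).
intros z _. apply (ex_derive_continuous (fun t => base t ^ n)). unfold base. auto_derive. easy.
Qed.

Lemma I_mean_pos (n : nat) : 0 <= I_mean n.
Proof.
assert (P := PI_RGT_0).
apply Rmult_le_pos.
- left. apply Rinv_0_lt_compat. lra.
- apply RInt_ge_0; [lra | apply base_pow_int |].
  intros x _. apply pow_le, base_bounds.
Qed.

Lemma I_mean_partial_sum (r : R) (N : nat) :
  is_RInt (fun t => sum_n (fun k => / INR (S k) * (r * base t) ^ S k) N) 0 (2 * PI)
    (2 * PI * sum_n (fun k => r ^ S k * (/ INR (S k) * I_mean (S k))) N).
Proof.
assert (P := PI_RGT_0).
assert (Hk : forall k, is_RInt (fun t => / INR (S k) * (r * base t) ^ S k) 0 (2 * PI)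
    (2 * PI * (r ^ S k * (/ INR (S k) * I_mean (S k))))).
{ intros k.
  apply is_RInt_ext with (fun t => scal (/ INR (S k) * r ^ S k) (base t ^ S k)).
  { intros x _. rewrite Rpow_mult_distr. unfold scal; simpl; unfold mult; simpl. ring. }
  replace (2 * PI * (r ^ S k * (/ INR (S k) * I_mean (S k))))
    with (scal (/ INR (S k) * r ^ S k) (RInt (fun t => base t ^ S k) 0 (2 * PI))).
  - apply (is_RInt_scal (V := R_NormedModule)), (RInt_correct (V := R_CompleteNormedModule)), base_pow_int.
  - unfold I_mean, base, scal; cbn -[INR pow]; unfold mult; cbn -[INR pow]. field.
    split; [lra | apply not_0_INR; lia]. }
induction N as [|N IH].
- rewrite sum_O. apply is_RInt_ext with (2 := Hk 0%nat). intros x _. now rewrite sum_O.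
- rewrite sum_Sn.
  apply is_RInt_ext with (fun t => plus (sum_n (fun k => / INR (S k) * (r * base t) ^ S k) N) (/ INR (S (S N)) * (r * base t) ^ S (S N))).
  { intros x _. now rewrite sum_Sn. }
  unfold plus at 2. cbn -[INR pow]. rewrite Rmult_plus_distr_l.
  now apply (is_RInt_plus (V := R_NormedModule)).
Qed.

(** The [r] for which [1 - r (2 + sin theta) / 3] is proportional to
    [1 - 2 rho sin theta + rho^2]. *)
Definition radius (rho : R) : R := 6 * rho / (1 + 4 * rho + rho ^ 2).

Lemma radius_bounds (rho : R) : 0 <= rho < 1 -> 0 <= radius rho < 1.
Proof.
intros H. unfold radius. assert (0 < 1 + 4 * rho + rho ^ 2) by (simpl; nra). split.
- apply Rmult_le_pos; [lra | left; now apply Rinv_0_lt_compat].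
- apply Rmult_lt_reg_r with (1 + 4 * rho + rho ^ 2); [assumption|].
  unfold Rdiv. rewrite Rmult_assoc, Rinv_l by lra. simpl. nra.
Qed.

Lemma log_integral (rho : R) :
  0 <= rho < 1 ->
  is_RInt (fun t => - ln (1 - radius rho * base t)) 0 (2 * PI)
    (2 * PI * ln (1 + 4 * rho + rho ^ 2)).
Proof.
intros H. assert (H1 : -1 < rho < 1) by lra.
assert (Hq : 0 < 1 + 4 * rho + rho ^ 2) by (simpl; nra).
apply is_RInt_ext with
  (fun t => minus (ln (1 + 4 * rho + rho ^ 2)) (jensen_integrand rho t)).
{ intros t _. unfold minus, plus, opp; cbn -[pow]. unfold jensen_integrand.
  assert (Hj := jensen_arg_bounds rho t H1).
  replace (1 - radius rho * base t) with
    ((1 - 2 * rho * sin t + rho ^ 2) * / (1 + 4 * rho + rho ^ 2)).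
  - rewrite ln_mult, ln_Rinv; [lra|assumption|assumption|now apply Rinv_0_lt_compat].
  - unfold radius, base. field. lra. }
replace (2 * PI * ln (1 + 4 * rho + rho ^ 2)) with
  (minus (scal (2 * PI - 0) (ln (1 + 4 * rho + rho ^ 2))) (jensen_integral rho)).
- apply (is_RInt_minus (V := R_NormedModule)).
  + apply (is_RInt_const (V := R_NormedModule)).
  + apply (RInt_correct (V := R_CompleteNormedModule)), jensen_integrand_int, H1.
- rewrite jensen_integral_zero by assumption.
  unfold minus, plus, opp, scal; cbn -[pow]; unfold mult; cbn -[pow]. ring.
Qed.

Lemma I_mean_abel_sum (rho : R) :
  0 <= rho < 1 ->
  is_series (fun k => radius rho ^ S k * (/ INR (S k) * I_mean (S k)))
    (ln (1 + 4 * rho + rho ^ 2)).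
Proof.
intros H. assert (P := PI_RGT_0).
assert (Hr := radius_bounds rho H). set (r := radius rho) in *.
assert (HN : forall N, Rabs (sum_n (fun k => r ^ S k * (/ INR (S k) * I_mean (S k))) N
              - ln (1 + 4 * rho + rho ^ 2)) <= / (1 - r) * r ^ S N).
{ intros N. rewrite Rabs_minus_sym.
  apply Rmult_le_reg_l with (2 * PI); [lra|].
  rewrite <- (Rabs_pos_eq (2 * PI)) at 1 by lra.
  rewrite <- Rabs_mult, Rmult_minus_distr_l.
  assert (Hi := is_RInt_minus (V := R_NormedModule) _ _ _ _ _ _ (log_integral rho H) (I_mean_partial_sum r N)).
  replace (2 * PI * (/ (1 - r) * r ^ S N)) with ((2 * PI - 0) * (r ^ S N / (1 - r)))
    by (unfold Rdiv; ring).
  apply (norm_RInt_le_const (V := R_NormedModule)) with (3 := Hi); [lra|].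
  intros t _. assert (Hb := base_bounds t).
  apply log_taylor_bound; [|lra]. split; nra. }
assert (Hl : is_lim_seq (fun N => / (1 - r) * r ^ S N) 0).
{ replace (Finite 0) with (Rbar_mult (/ (1 - r)) 0) by (simpl; f_equal; ring).
  apply is_lim_seq_scal_l. apply -> is_lim_seq_incr_1.
  apply is_lim_seq_geom. rewrite Rabs_pos_eq; lra. }
change (is_lim_seq (sum_n (fun k => r ^ S k * (/ INR (S k) * I_mean (S k)))) (ln (1 + 4 * rho + rho ^ 2))).
apply is_lim_seq_ext with (fun N => (sum_n (fun k => r ^ S k * (/ INR (S k) * I_mean (S k))) N
   - ln (1 + 4 * rho + rho ^ 2)) + ln (1 + 4 * rho + rho ^ 2)).
{ intros n. ring. }
replace (Finite (ln (1 + 4 * rho + rho ^ 2))) with (Finite (0 + ln (1 + 4 * rho + rho ^ 2)))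
  by (f_equal; ring).
apply is_lim_seq_plus'; [|apply is_lim_seq_const].
apply is_lim_seq_abs_0.
apply is_lim_seq_le_le with (3 := Hl) (u := fun _ => 0); [|apply is_lim_seq_const].
intros n. split; [apply Rabs_pos | apply HN].
Qed.

(** Abel summability gives convergence here without a Tauberian condition: for
    nonnegative terms each partial sum is at most the Abel limit, and each Abel sum
    is at most the sum of the series. *)
Lemma is_series_of_abel_nonneg (u r ell : nat -> R) (l : R) :
  (forall k, 0 <= u k) -> (forall m, 0 <= r m <= 1) ->
  is_lim_seq r 1 -> is_lim_seq ell l ->
  (forall m, is_series (fun k => r m ^ S k * u k) (ell m)) -> is_series u l.
Proof.
intros Hu Hr Lr Ll Hs.
assert (Inc : forall v : nat -> R, (forall k, 0 <= v k) -> forall n, sum_n v n <= sum_n v (S n)).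
{ intros v Hv n. rewrite sum_Sn. unfold plus; simpl. specialize (Hv (S n)). lra. }
assert (Up : forall N, sum_n u N <= l).
{ intros N.
  apply (is_lim_seq_le (fun m => sum_n (fun k => r m ^ S k * u k) N) ell (sum_n u N) l);
    [| |exact Ll].
  - intros m. apply (is_lim_seq_incr_compare (sum_n (fun k => r m ^ S k * u k))).
    + apply (Hs m).
    + apply Inc. intros k. apply Rmult_le_pos; [apply pow_le, Hr | apply Hu].
  - assert (Hp : forall k, is_lim_seq (fun m => r m ^ S k * u k) (u k)).
    { intros k.
      assert (Hp : is_lim_seq (fun m => r m ^ S k) 1).
      { induction k as [|k IH].
        - apply is_lim_seq_ext with (2 := Lr). intros; simpl; ring.
        - replace (Finite 1) with (Finite (1 * 1)) by (f_equal; ring).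
          apply (is_lim_seq_mult' r (fun m => r m ^ S k)); assumption. }
      replace (Finite (u k)) with (Rbar_mult 1 (u k)) by (simpl; f_equal; ring).
      now apply is_lim_seq_scal_r. }
    induction N as [|N IH].
    + rewrite sum_O. apply is_lim_seq_ext with (2 := Hp 0%nat). intros m. now rewrite sum_O.
    + rewrite sum_Sn.
      apply is_lim_seq_ext with (fun m => sum_n (fun k => r m ^ S k * u k) N + r m ^ S (S N) * u (S N)).
      * intros m. now rewrite sum_Sn.
      * apply is_lim_seq_plus'; [exact IH | apply Hp]. }
destruct (ex_finite_lim_seq_incr (sum_n u) l (Inc u Hu) Up) as [s Ls].
assert (s <= l).
{ apply (is_lim_seq_le (sum_n u) (fun _ => l) s l); [exact Up|exact Ls|apply is_lim_seq_const]. }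
assert (l <= s).
{ apply (is_lim_seq_le ell (fun _ => s) l s); [|exact Ll|apply is_lim_seq_const].
  intros m.
  apply (is_lim_seq_le (sum_n (fun k => r m ^ S k * u k)) (sum_n u) (ell m) s);
    [|apply (Hs m)|exact Ls].
  intros n. apply sum_n_m_le. intros k.
  rewrite <- (Rmult_1_l (u k)) at 2. apply Rmult_le_compat_r; [apply Hu|].
  rewrite <- (pow1 (S k)). apply pow_incr, Hr. }
replace l with s by lra. exact Ls.
Qed.

Lemma I_mean_log_sum : is_series (fun k => / INR (S k) * I_mean (S k)) (ln 6).
Proof.
set (rho := fun m => 1 - (1 / 2) ^ m).
assert (Hrho : forall m, 0 <= rho m < 1).
{ intros m. unfold rho.
  assert (0 < (1 / 2) ^ m) by (apply pow_lt; lra).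
  assert ((1 / 2) ^ m <= 1 ^ m) by (apply pow_incr; lra).
  rewrite pow1 in *. lra. }
assert (Lrho : is_lim_seq rho 1).
{ replace (Finite 1) with (Finite (1 - 0)) by (f_equal; ring).
  apply is_lim_seq_minus'; [apply is_lim_seq_const|].
  apply is_lim_seq_geom. rewrite Rabs_pos_eq; lra. }
apply (is_series_of_abel_nonneg _ (fun m => radius (rho m))
         (fun m => ln (1 + 4 * rho m + rho m ^ 2))).
- intros k. apply Rmult_le_pos; [|apply I_mean_pos].
  left. apply Rinv_0_lt_compat, lt_0_INR. lia.
- intros m. generalize (radius_bounds (rho m) (Hrho m)). lra.
- replace (Finite 1) with (Finite (radius 1)) by (unfold radius; f_equal; field).
  apply (is_lim_seq_continuous radius); [|exact Lrho].
  apply continuity_pt_filterlim, (ex_derive_continuous radius).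
  unfold radius. auto_derive. lra.
- replace 6 with (1 + 4 * 1 + 1 ^ 2) by ring.
  apply (is_lim_seq_continuous (fun x => ln (1 + 4 * x + x ^ 2))); [|exact Lrho].
  apply continuity_pt_filterlim, (ex_derive_continuous (fun x => ln (1 + 4 * x + x ^ 2))).
  auto_derive. lra.
- intros m. now apply I_mean_abel_sum.
Qed.

Lemma S_BBG_iff_R (s : R) : is_S_BBG s <-> is_R (s - ln 6).
Proof.
unfold is_S_BBG, is_R, sum_from_one. split; intros H.
- apply is_series_ext with (fun k => minus (bbg_term (S k)) (/ INR (S k) * I_mean (S k))).
  + intros k. unfold bbg_term, R_term, minus, plus, opp; cbn -[INR pow I_mean]. ring.
  + apply (is_series_minus (V := R_NormedModule)); [exact H | exact I_mean_log_sum].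
- apply is_series_ext with (fun k => plus (R_term (S k)) (/ INR (S k) * I_mean (S k))).
  + intros k. unfold bbg_term, R_term, plus; cbn -[INR pow I_mean]. ring.
  + replace s with (plus (s - ln 6) (ln 6)) by (unfold plus; simpl; ring).
    apply (is_series_plus (V := R_NormedModule)); [exact H | exact I_mean_log_sum].
Qed.

(** * The exponential integral *)

Definition exp_coeff (n : nat) : R := / INR (fact n).

(** The coefficients of the series of [x^n / (n n!)], as the termwise integral of
    [(exp x - 1) / x], so that the derivative of [ein] comes from the general theory. *)
Definition ein_coeff : nat -> R := PS_Int (PS_decr_1 exp_coeff).

Definition ein (x : R) : R := PSeries ein_coeff x.

Lemma CV_radius_exp_coeff : CV_radius exp_coeff = p_infty.
Proof.
apply CV_radius_infinite_DAlembert.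
- intros n. apply Rinv_neq_0_compat, INR_fact_neq_0.
- apply is_lim_seq_ext with (fun n => / INR (S n)).
  + intros n. unfold exp_coeff. rewrite fact_simpl, mult_INR.
    assert (0 < INR (S n)) by (apply lt_0_INR; lia).
    assert (Hf := INR_fact_neq_0 n).
    replace (/ (INR (S n) * INR (fact n)) / / INR (fact n)) with (/ INR (S n)).
    * rewrite Rabs_pos_eq; [easy|]. left. now apply Rinv_0_lt_compat.
    * field. split; lra.
  + replace (Finite 0) with (Rbar_inv p_infty) by easy.
    apply is_lim_seq_inv; [|easy]. apply -> is_lim_seq_incr_1. apply is_lim_seq_INR.
Qed.

Lemma ein_derive (x : R) : x <> 0 -> is_derive ein x ((exp x - 1) / x).
Proof.
intros Hx. unfold ein, ein_coeff.
replace ((exp x - 1) / x) with (PSeries (PS_derive (PS_Int (PS_decr_1 exp_coeff))) x).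
- apply is_derive_PSeries. now rewrite CV_radius_Int, CV_radius_decr_1, CV_radius_exp_coeff.
- rewrite (PSeries_ext _ (PS_decr_1 exp_coeff)).
  + rewrite exp_Reals, (PSeries_decr_1 (fun n => / INR (fact n))).
    * change (PS_decr_1 (fun n => / INR (fact n))) with (PS_decr_1 exp_coeff). simpl. field. assumption.
    * apply CV_radius_inside. fold exp_coeff. now rewrite CV_radius_exp_coeff.
  + intros n. unfold PS_derive, PS_Int. field. apply not_0_INR. lia.
Qed.

Lemma ein_continuous (x : R) : continuous ein x.
Proof.
apply (ex_derive_continuous ein). eexists. apply is_derive_PSeries.
unfold ein_coeff. now rewrite CV_radius_Int, CV_radius_decr_1, CV_radius_exp_coeff.
Qed.

Definition expint_prim (x : R) : R := ln (Rabs x) + ein x.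

Lemma expint_prim_derive (x : R) : x <> 0 -> is_derive expint_prim x (exp x / x).
Proof.
intros Hx.
replace (exp x / x) with (/ x + (exp x - 1) / x) by (field; exact Hx).
apply (is_derive_plus (fun x => ln (Rabs x)) ein); [|now apply ein_derive].
replace (/ x) with ((sign x * 1) * / Rabs x).
- apply (is_derive_comp ln (fun x => Rabs x)).
  + apply is_derive_ln. now apply Rabs_pos_lt.
  + apply (is_derive_Rabs (fun x => x)); [exact (is_derive_id x) | exact Hx].
- destruct (Rdichotomy _ _ Hx) as [H|H].
  + rewrite sign_eq_m1, Rabs_left by assumption. field. lra.
  + rewrite sign_eq_1, Rabs_pos_eq by lra. field. lra.
Qed.

Lemma expint_RInt (a b : R) :
  0 < a * b ->
  is_RInt (fun u => exp u / u) a b (expint_prim b - expint_prim a).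
Proof.
intros Hab.
assert (H0 : forall x, Rmin a b <= x <= Rmax a b -> x <> 0).
{ intros x Hx ->. revert Hx. unfold Rmin, Rmax. destruct (Rle_dec a b); intros; nra. }
apply (is_RInt_derive (V := R_CompleteNormedModule) expint_prim).
- intros x Hx. now apply expint_prim_derive, H0.
- intros x Hx. apply H0 in Hx. apply (ex_derive_continuous (fun u => exp u / u)).
  auto_derive. exact Hx.
Qed.

(** On [[a, b]] with [b < 0], the integrand [exp u / u] is negative and at most
    [exp u / |b|] in absolute value. *)
Lemma expint_prim_diff_neg (a b : R) :
  a < b < 0 -> 0 <= expint_prim a - expint_prim b <= / - b * (exp b - exp a).
Proof.
intros H.
assert (I := is_RInt_opp (V := R_NormedModule) _ _ _ _ (expint_RInt a b ltac:(nra))).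
assert (E : is_RInt (fun u => scal (/ - b) (exp u)) a b (scal (/ - b) (exp b - exp a))).
{ apply (is_RInt_scal (V := R_NormedModule)).
  apply (is_RInt_derive (V := R_CompleteNormedModule) exp); intros x _.
  - apply is_derive_exp.
  - apply continuous_exp. }
assert (Hb : forall x, a < x < b -> 0 <= - (exp x / x) <= / - b * exp x).
{ intros x Hx. generalize (exp_pos x). intros Ex.
  assert (0 < / - x <= / - b).
  { split; [apply Rinv_0_lt_compat | apply Rinv_le_contravar]; lra. }
  replace (- (exp x / x)) with (/ - x * exp x) by (field; lra).
  split; [apply Rmult_le_pos | apply Rmult_le_compat_r]; lra. }
replace (expint_prim a - expint_prim b) with (opp (expint_prim b - expint_prim a))
  by (unfold opp; simpl; ring).
split.
- apply (is_RInt_ge_0 _ a b _ ltac:(lra) I). intros x Hx. now apply Hb.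
- apply (is_RInt_le _ _ a b _ _ ltac:(lra) I E). intros x Hx. now apply Hb.
Qed.

(** The primitive decreases on the negative half-line and is bounded there, so its
    limit is its supremum; the same comparison with [exp u / A] measures how close
    the value at [- A] is to it. *)
Lemma expint_prim_lim_m_infty :
  exists L : R, is_lim expint_prim m_infty L /\
    forall A, 0 < A -> expint_prim (- A) <= L <= expint_prim (- A) + / A * exp (- A).
Proof.
set (E := fun y => exists A, 0 < A /\ y = expint_prim (- A)).
assert (Ub : forall A B, 0 < A -> 0 < B ->
   expint_prim (- B) <= expint_prim (- A) + / A * exp (- A)).
{ intros A B HA HB.
  assert (EA := exp_pos (- A)). assert (EB := exp_pos (- B)).
  assert (IA : 0 < / A) by now apply Rinv_0_lt_compat.
  destruct (Rtotal_order A B) as [H|[->|H]].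
  - generalize (expint_prim_diff_neg (- B) (- A) ltac:(lra)). rewrite Ropp_involutive. nra.
  - nra.
  - generalize (expint_prim_diff_neg (- A) (- B) ltac:(lra)). nra. }
destruct (completeness E) as [L [HL1 HL2]].
- exists (expint_prim (- 1) + / 1 * exp (- 1)). intros y [A [HA ->]]. apply Ub; lra.
- exists (expint_prim (- 1)), 1. split; [lra | easy].
- exists L.
  assert (HL : forall A, 0 < A -> expint_prim (- A) <= L).
  { intros A HA. apply HL1. now exists A. }
  split.
  + apply is_lim_spec. intros eps.
    assert (Hex : exists A, 0 < A /\ L - eps < expint_prim (- A)).
    { apply Classical_Prop.NNPP. intros Hn.
      assert (L <= L - eps); [|generalize (cond_pos eps); lra].
      apply HL2. intros y [A [HA ->]].
      apply Rnot_lt_le. intros Hlt. apply Hn. now exists A. }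
    destruct Hex as [A [HA Hlt]]. exists (- A). intros x Hx.
    assert (H1 := HL (- x) ltac:(lra)). rewrite Ropp_involutive in H1.
    assert (H2 := expint_prim_diff_neg x (- A) ltac:(lra)).
    apply Rabs_def1; lra.
  + intros A HA. split; [now apply HL|].
    apply HL2. intros y [B [HB ->]]. now apply Ub.
Qed.

Lemma expint_RInt_gen (L b : R) :
  is_lim expint_prim m_infty L -> b < 0 ->
  is_RInt_gen (fun u => exp u / u) (Rbar_locally m_infty) (at_point b) (expint_prim b - L).
Proof.
intros HL Hb P HP.
assert (HF : filterlim (fun x => expint_prim b - expint_prim x) (Rbar_locally m_infty)
          (locally (expint_prim b - L))).
{ apply (is_lim_minus' (fun _ => expint_prim b) expint_prim m_infty); [apply is_lim_const | exact HL]. }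
specialize (HF P HP).
apply (Filter_prod _ _ _ (fun x => P (expint_prim b - expint_prim x) /\ x < b) (fun y => y = b)).
- apply filter_and; [exact HF | now exists b].
- easy.
- intros x y [Hx Hxb] ->. exists (expint_prim b - expint_prim x). split; [|exact Hx].
  apply expint_RInt. simpl. nra.
Qed.

(** The two endpoints at distance [eps] from 0 contribute
    [expint_prim (- eps) - expint_prim eps], in which the logarithms cancel and the
    rest tends to 0. *)
Lemma Ei_eq (L t : R) :
  is_lim expint_prim m_infty L -> 0 < t -> Ei t = expint_prim t - L.
Proof.
intros HL Ht. unfold Ei.
apply (iota_filterlim_locally (V := R_CompleteNormedModule) (Ei_cut t)).
apply filterlim_ext_loc with (fun eps => expint_prim t - L + (ein (- eps) - ein eps)).
- exists (mkposreal 1 Rlt_0_1). intros eps _ He. unfold Ei_cut.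
  assert (Hneg := expint_RInt_gen L (- eps) HL ltac:(lra)).
  assert (Hpos := expint_RInt eps t ltac:(nra)).
  apply (is_RInt_gen_unique (V := R_CompleteNormedModule)) in Hneg.
  apply (is_RInt_unique (V := R_CompleteNormedModule)) in Hpos.
  rewrite Hneg, Hpos.
  unfold expint_prim. rewrite Rabs_Ropp. ring.
- assert (C : continuous (fun eps => expint_prim t - L + (ein (- eps) - ein eps)) 0).
  { apply (continuous_plus (fun _ => expint_prim t - L) (fun eps => ein (- eps) - ein eps));
      [apply continuous_const|].
    apply (continuous_minus (fun eps => ein (- eps)) ein); [|apply ein_continuous].
    apply (continuous_comp Ropp ein); [|apply ein_continuous].
    apply (ex_derive_continuous Ropp). auto_derive. easy. }
  unfold continuous in C. rewrite Ropp_0, Rminus_diag, Rplus_0_r in C.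
  apply filterlim_filter_le_1 with (2 := C). apply filter_le_within.
Qed.

(** * Rational enclosures of Taylor series *)

(** The terms after [u N] are dominated by [|u N| / 2], [|u N| / 4] and so on. *)
Lemma geometric_tail_bound (u : nat -> R) (s : R) (N : nat) :
  is_series u s -> (forall n, (N <= n)%nat -> Rabs (u (S n)) <= Rabs (u n) / 2) ->
  Rabs (s - sum_n u N) <= Rabs (u N).
Proof.
intros Hs Hu.
assert (Hk : forall k, Rabs (u (N + k)%nat) <= Rabs (u N) * (1 / 2) ^ k /\
     Rabs (sum_n u (N + k) - sum_n u N) <= Rabs (u N) * (1 - (1 / 2) ^ k)).
{ induction k as [|k [IH1 IH2]].
  - rewrite Nat.add_0_r, Rminus_diag, Rabs_R0. simpl. lra.
  - rewrite Nat.add_succ_r. specialize (Hu (N + k)%nat ltac:(lia)).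
    assert (H1 : Rabs (u (S (N + k))) <= Rabs (u N) * (1 / 2) ^ S k) by (simpl; lra).
    split; [exact H1|].
    rewrite sum_Sn.
    replace (plus (sum_n u (N + k)) (u (S (N + k))) - sum_n u N) with
      ((sum_n u (N + k) - sum_n u N) + u (S (N + k)))
      by (unfold plus; simpl; ring).
    apply Rle_trans with (1 := Rabs_triang _ _).
    replace ((1 / 2) ^ S k) with (1 / 2 * (1 / 2) ^ k) in * by (simpl; ring). lra. }
apply (is_lim_seq_le (fun k => Rabs (sum_n u (N + k) - sum_n u N)) (fun _ => Rabs (u N))
         (Rabs (s - sum_n u N)) (Rabs (u N))); [| |apply is_lim_seq_const].
- intros k. apply Rle_trans with (1 := proj2 (Hk k)).
  assert (0 <= (1 / 2) ^ k) by (apply pow_le; lra). generalize (Rabs_pos (u N)). nra.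
- apply (is_lim_seq_abs _ (Finite (s - sum_n u N))).
  apply is_lim_seq_minus'; [|apply is_lim_seq_const].
  apply is_lim_seq_ext with (fun k => sum_n u (k + N)); [intros k; now rewrite Nat.add_comm|].
  apply (is_lim_seq_incr_n (sum_n u) N). exact Hs.
Qed.

(** Evaluates the sum of [w n * x^n / n!] over [k <= n <= k + m], divided by
    [x^k / k!].  Nesting the products keeps the denominators of size about
    [m! * den x ^ m], where adding fractions term by term would make them much
    larger. *)
Fixpoint horner (w : nat -> Q) (x : Q) (m k : nat) : Q :=
  match m with
  | O => w k
  | S m' => (w k + x * (1 # Pos.of_succ_nat k) * horner w x m' (S k))%Q
  end.

Fixpoint exp_term (x : Q) (n : nat) : Q :=
  match n with
  | O => 1%Q
  | S n' => (x * (1 # Pos.of_succ_nat n') * exp_term x n')%Q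
  end.

Lemma Q2R_inv_succ (k : nat) : Q2R (1 # Pos.of_succ_nat k) = / INR (S k).
Proof.
unfold Q2R. cbn [Qnum Qden].
rewrite INR_IZR_INZ, Znat.Nat2Z.inj_succ, <- Znat.Zpos_P_of_succ_nat. ring.
Qed.

Lemma Q2R_exp_term (x : Q) (n : nat) : Q2R (exp_term x n) = Q2R x ^ n / INR (fact n).
Proof.
induction n as [|n IH].
- simpl. rewrite RMicromega.Q2R_1. field.
- cbn [exp_term]. rewrite !Q2R_mult, IH, Q2R_inv_succ, fact_simpl, mult_INR.
  cbn [pow]. field. split; [apply INR_fact_neq_0 | apply not_0_INR; lia].
Qed.

Lemma Q2R_horner (w : nat -> Q) (x : Q) (m k : nat) :
  Q2R (horner w x m k) * Q2R (exp_term x k) =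
  sum_n_m (fun n => Q2R (w n) * Q2R (exp_term x n)) k (k + m).
Proof.
revert k. induction m as [|m IH]; intros k.
- rewrite Nat.add_0_r, sum_n_n. reflexivity.
- rewrite Nat.add_succ_r, <- Nat.add_succ_l, sum_Sn_m by lia. rewrite <- IH.
  cbn [horner exp_term]. rewrite Q2R_plus, !Q2R_mult. unfold plus; cbn -[Q2R]. ring.
Qed.

Definition taylor_lo (w : nat -> Q) (x : Q) (N : nat) : Q :=
  (horner w x N 0 - Qabs.Qabs (exp_term x N))%Q.

Definition taylor_hi (w : nat -> Q) (x : Q) (N : nat) : Q :=
  (horner w x N 0 + Qabs.Qabs (exp_term x N))%Q.

Lemma Q2R_abs (x : Q) : Q2R (Qabs.Qabs x) = Rabs (Q2R x).
Proof.
apply Qabs.Qabs_case; intros H; apply Qle_Rle in H; rewrite RMicromega.Q2R_0 in H.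
- now rewrite Rabs_pos_eq.
- now rewrite Rabs_left1, Q2R_opp.
Qed.

(** Once [2 |x| <= N], the ratio of consecutive terms is at most 1/2, so the last term
    kept bounds the remainder; [w N <= 1] lets the weight be dropped from it.  The
    requirement on [w] starts at [n = 1] because the weight of [ein] is 0 at 0. *)
Lemma taylor_enclosure (w : nat -> Q) (x : Q) (N : nat) (s : R) :
  (forall n, (1 <= n)%nat -> 0 <= Q2R (w (S n)) <= Q2R (w n) /\ Q2R (w n) <= 1) ->
  Qle_bool (2 * Qabs.Qabs x) (inject_Z (Z.of_nat N)) = true -> (1 <= N)%nat ->
  is_series (fun n => Q2R (w n) * (Q2R x ^ n / INR (fact n))) s ->
  Q2R (taylor_lo w x N) <= s <= Q2R (taylor_hi w x N).
Proof.
intros Hw HN HN1 Hs.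
apply Qle_bool_imp_le, Qle_Rle in HN.
rewrite Q2R_mult, Q2R_abs in HN.
replace (Q2R 2) with 2 in HN by (unfold Q2R; simpl; lra).
replace (Q2R (inject_Z (Z.of_nat N))) with (INR N) in HN
  by (unfold Q2R; simpl; rewrite <- INR_IZR_INZ; lra).
assert (Hu : Rabs (s - sum_n (fun n => Q2R (w n) * Q2R (exp_term x n)) N)
             <= Rabs (Q2R (w N) * Q2R (exp_term x N))).
{ apply geometric_tail_bound.
  - apply is_series_ext with (2 := Hs). intros n. now rewrite Q2R_exp_term.
  - intros n Hn. cbn [exp_term]. rewrite !Q2R_mult, Q2R_inv_succ, !Rabs_mult.
    destruct (Hw n ltac:(lia)) as [Hw1 Hw2].
    rewrite (Rabs_pos_eq (Q2R (w (S n)))) by lra.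
    rewrite (Rabs_pos_eq (Q2R (w n))) by lra.
    assert (Hp : 0 < INR (S n)) by (apply lt_0_INR; lia).
    rewrite (Rabs_pos_eq (/ INR (S n))) by (left; now apply Rinv_0_lt_compat).
    assert (Hx : Rabs (Q2R x) * / INR (S n) <= / 2).
    { apply Rmult_le_reg_r with (INR (S n)); [assumption|].
      rewrite Rmult_assoc, Rinv_l, Rmult_1_r by lra.
      assert (INR N <= INR (S n)) by (apply le_INR; lia). lra. }
    assert (Ht := Rabs_pos (Q2R (exp_term x n))).
    apply Rle_trans with (Q2R (w n) * (/ 2 * Rabs (Q2R (exp_term x n)))); [|right; field].
    apply Rmult_le_compat; try lra.
    + apply Rmult_le_pos; [|assumption]. apply Rmult_le_pos; [apply Rabs_pos|].
      left; now apply Rinv_0_lt_compat.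
    + now apply Rmult_le_compat_r. }
rewrite Rabs_mult in Hu.
assert (Hw1 : 0 <= Q2R (w N) <= 1) by (destruct (Hw N HN1); lra).
rewrite (Rabs_pos_eq (Q2R (w N))) in Hu by lra.
assert (Ht := Rabs_pos (Q2R (exp_term x N))).
assert (Hh := Q2R_horner w x N 0). simpl exp_term in Hh.
rewrite RMicromega.Q2R_1, Rmult_1_r in Hh. simpl in Hh. fold (sum_n (fun n => Q2R (w n) * Q2R (exp_term x n)) N) in Hh.
rewrite <- Hh in Hu.
unfold taylor_lo, taylor_hi, Qminus. rewrite !Q2R_plus, Q2R_opp, Q2R_abs.
assert (Hv : Rabs (s - Q2R (horner w x N 0)) <= Rabs (Q2R (exp_term x N))) by nra.
apply Rabs_le_between in Hv. lra.
Qed.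

Definition exp_weight (n : nat) : Q := 1.

Definition ein_weight (n : nat) : Q :=
  match n with O => 0 | S n' => 1 # Pos.of_succ_nat n' end.

Lemma exp_enclosure (x : Q) (N : nat) :
  Qle_bool (2 * Qabs.Qabs x) (inject_Z (Z.of_nat N)) = true -> (1 <= N)%nat ->
  Q2R (taylor_lo exp_weight x N) <= exp (Q2R x) <= Q2R (taylor_hi exp_weight x N).
Proof.
intros HN HN1. apply taylor_enclosure; try assumption.
- intros n _. unfold exp_weight. rewrite RMicromega.Q2R_1. lra.
- generalize (is_exp_Reals (Q2R x)). apply is_series_ext. intros n.
  unfold exp_weight. rewrite RMicromega.Q2R_1, pow_n_pow.
  unfold scal; simpl; unfold mult; simpl. unfold Rdiv. ring.
Qed.

Lemma ein_enclosure (x : Q) (N : nat) :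
  Qle_bool (2 * Qabs.Qabs x) (inject_Z (Z.of_nat N)) = true -> (1 <= N)%nat ->
  Q2R (taylor_lo ein_weight x N) <= ein (Q2R x) <= Q2R (taylor_hi ein_weight x N).
Proof.
intros HN HN1. apply taylor_enclosure; try assumption.
- intros n Hn. destruct n as [|n]; [lia|]. unfold ein_weight. rewrite !Q2R_inv_succ.
  assert (0 < INR (S n)) by (apply lt_0_INR; lia).
  assert (1 <= INR (S n)) by (apply (le_INR 1); lia).
  rewrite (S_INR (S n)). repeat split.
  + left; apply Rinv_0_lt_compat; lra.
  + apply Rinv_le_contravar; lra.
  + rewrite <- Rinv_1. apply Rinv_le_contravar; lra.
- assert (H : is_pseries ein_coeff (Q2R x) (ein (Q2R x))).
  { apply PSeries_correct, CV_radius_inside. unfold ein_coeff.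
    now rewrite CV_radius_Int, CV_radius_decr_1, CV_radius_exp_coeff. }
  revert H. apply is_series_ext. intros [|n]; rewrite pow_n_pow;
  unfold scal; cbn -[Q2R pow INR fact]; unfold mult; cbn -[Q2R pow INR fact].
  + rewrite RMicromega.Q2R_0. ring.
  + rewrite Q2R_inv_succ. unfold PS_decr_1, exp_coeff. field.
    split; [apply INR_fact_neq_0 | apply not_0_INR; lia].
Qed.

(** * Numerical value *)

(** Comparing exponentials turns bounds on logarithms into evaluations of the Taylor
    polynomials of [exp]. *)
Lemma ln_ge_by_exp (a b : Q) (N : nat) :
  Qle_bool (2 * Qabs.Qabs a) (inject_Z (Z.of_nat N)) = true -> (1 <= N)%nat ->
  Qle_bool (taylor_hi exp_weight a N) b = true -> Q2R a <= ln (Q2R b).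
Proof.
intros HN HN1 Hb. apply Qle_bool_imp_le, Qle_Rle in Hb.
destruct (exp_enclosure a N HN HN1) as [_ He].
rewrite <- (ln_exp (Q2R a)). apply ln_le; [apply exp_pos | lra].
Qed.

Lemma ln_le_by_exp (a b : Q) (N : nat) :
  Qle_bool (2 * Qabs.Qabs a) (inject_Z (Z.of_nat N)) = true -> (1 <= N)%nat ->
  Qle_bool b (taylor_lo exp_weight a N) = true -> 0 < Q2R b -> ln (Q2R b) <= Q2R a.
Proof.
intros HN HN1 Hb Hp. apply Qle_bool_imp_le, Qle_Rle in Hb.
destruct (exp_enclosure a N HN HN1) as [He _].
rewrite <- (ln_exp (Q2R a)). apply ln_le; lra.
Qed.

Ltac decide_bool := vm_compute; reflexivity.

Lemma ln_2_bounds : 0.693147180559945 <= ln 2 <= 0.693147180559946.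
Proof.
replace 2 with (Q2R 2) by (unfold Q2R; simpl; lra). split.
- replace 0.693147180559945 with (Q2R (693147180559945 # 1000000000000000))
    by (unfold Q2R; simpl; lra).
  apply (ln_ge_by_exp _ _ 20); [decide_bool | lia | decide_bool].
- replace 0.693147180559946 with (Q2R (693147180559946 # 1000000000000000))
    by (unfold Q2R; simpl; lra).
  apply (ln_le_by_exp _ _ 20); [decide_bool | lia | decide_bool | unfold Q2R; simpl; lra].
Qed.

Definition ln3_lo : Q := 1098612288668109 # 1000000000000000.
Definition ln3_hi : Q := 1098612288668110 # 1000000000000000.

Lemma ln_3_bounds : Q2R ln3_lo <= ln 3 <= Q2R ln3_hi.
Proof.
replace 3 with (Q2R 3) by (unfold Q2R; simpl; lra). split.
- apply (ln_ge_by_exp _ _ 20); [decide_bool | lia | decide_bool].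
- apply (ln_le_by_exp _ _ 20); [decide_bool | lia | decide_bool | unfold Q2R; simpl; lra].
Qed.

Lemma expint_prim_incr (a b : R) : 0 < a <= b -> expint_prim a <= expint_prim b.
Proof.
intros H.
assert (0 <= expint_prim b - expint_prim a); [|lra].
apply (is_RInt_ge_0 (fun u => exp u / u) a b); [lra | apply expint_RInt; nra |].
intros x Hx. left. apply Rdiv_lt_0_compat; [apply exp_pos | lra].
Qed.

Lemma expint_prim_ln_3_bounds :
  1.586372929765656 <= expint_prim (ln 3) <= 1.586372929765663.
Proof.
assert (Hl : 0 < Q2R ln3_lo) by (unfold Q2R; simpl; lra).
assert (Hh : 0 < Q2R ln3_hi) by (unfold Q2R; simpl; lra).
destruct ln_3_bounds as [B1 B2]. split.
- apply Rle_trans with (2 := expint_prim_incr _ _ (conj Hl B1)).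
  unfold expint_prim. rewrite Rabs_pos_eq by lra.
  assert (H1 : Q2R (94047827616698 # 1000000000000000) <= ln (Q2R ln3_lo)).
  { apply (ln_ge_by_exp _ _ 20); [decide_bool | lia | decide_bool]. }
  assert (H2 : Q2R (1492325102148958 # 1000000000000000) <= ein (Q2R ln3_lo)).
  { refine (Rle_trans _ _ _ _ (proj1 (ein_enclosure ln3_lo 20 _ _))); [|decide_bool|lia].
    apply Qle_Rle, Qle_bool_imp_le. decide_bool. }
  set (l := ln (Q2R ln3_lo)) in *. set (e := ein (Q2R ln3_lo)) in *. clearbody l e.
  unfold Q2R in H1, H2. simpl in H1, H2. lra.
- apply Rle_trans with (1 := expint_prim_incr _ _ (conj (Rlt_le_trans _ _ _ Hl B1) B2)).
  unfold expint_prim. rewrite Rabs_pos_eq by lra.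
  assert (H1 : ln (Q2R ln3_hi) <= Q2R (94047827616701 # 1000000000000000)).
  { apply (ln_le_by_exp _ _ 20); [decide_bool | lia | decide_bool | exact Hh]. }
  assert (H2 : ein (Q2R ln3_hi) <= Q2R (1492325102148962 # 1000000000000000)).
  { refine (Rle_trans _ _ _ (proj2 (ein_enclosure ln3_hi 20 _ _)) _); [decide_bool|lia|].
    apply Qle_Rle, Qle_bool_imp_le. decide_bool. }
  set (l := ln (Q2R ln3_hi)) in *. set (e := ein (Q2R ln3_hi)) in *. clearbody l e.
  unfold Q2R in H1, H2. simpl in H1, H2. lra.
Qed.

Lemma ein_m32_bounds : -4.042951567701260 <= ein (- 32) <= -4.042951567701259.
Proof.
replace (- 32) with (Q2R (- 32 # 1)) by (unfold Q2R; simpl; lra).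
(* The terms 32^n / n! grow up to n = 32; at n = 120 they are below 1e-17. *)
generalize (ein_enclosure (- 32 # 1) 120 ltac:(decide_bool) ltac:(lia)). intros [H1 H2].
split.
- refine (Rle_trans _ _ _ _ H1).
  replace (-4.042951567701260) with (Q2R (- 4042951567701260 # 1000000000000000))
    by (unfold Q2R; simpl; lra).
  apply Qle_Rle, Qle_bool_imp_le. decide_bool.
- refine (Rle_trans _ _ _ H2 _).
  replace (-4.042951567701259) with (Q2R (- 4042951567701259 # 1000000000000000))
    by (unfold Q2R; simpl; lra).
  apply Qle_Rle, Qle_bool_imp_le. decide_bool.
Qed.

Lemma exp_m32_bound : exp (- 32) <= 1 / 10 ^ 13.
Proof.
replace (- 32) with (Q2R (- 32 # 1)) by (unfold Q2R; simpl; lra).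
refine (Rle_trans _ _ _ (proj2 (exp_enclosure (- 32 # 1) 120 ltac:(decide_bool) ltac:(lia))) _).
replace (1 / 10 ^ 13) with (Q2R (1 # 10000000000000)) by (unfold Q2R; simpl; lra).
apply Qle_Rle, Qle_bool_imp_le. decide_bool.
Qed.

Lemma Ei_ln_3_bounds : 0.371829125439 <= Ei (ln 3) - ln 6 < 0.371829125440.
Proof.
destruct expint_prim_lim_m_infty as [L [HL B]].
assert (H3 : 0 < ln 3) by (rewrite <- ln_1; apply ln_increasing; lra).
rewrite (Ei_eq L) by assumption.
(* The value exceeds the claimed lower bound by about 1.4e-13, well above the error
   exp (-32) / 32, about 4e-16; and 32 is a power of 2, so that ln 32 = 5 ln 2. *)
specialize (B 32 ltac:(lra)). unfold expint_prim at 1 2 in B.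
rewrite Rabs_Ropp, Rabs_pos_eq in B by lra.
change (- (32)) with (-32) in B.
replace (ln 32) with (5 * ln 2) in B.
2:{ replace 32 with (2 ^ 5) by ring. rewrite ln_pow by lra. simpl. ring. }
replace (ln 6) with (ln 2 + ln 3) by (rewrite <- ln_mult by lra; f_equal; ring).
assert (L2 := ln_2_bounds). assert (L3 := ln_3_bounds).
assert (G3 := expint_prim_ln_3_bounds).
assert (E32 := ein_m32_bounds). assert (X32 := exp_m32_bound).
unfold Q2R in L3. simpl in L3, X32. lra.
Qed.

Theorem theorem6p3 :
  (is_S_BBG (Ei (ln 3)) <-> is_R (Ei (ln 3) - ln 6))
  /\ 0.371829125439 <= Ei (ln 3) - ln 6 < 0.371829125440.
Proof.
split; [apply S_BBG_iff_R | exact Ei_ln_3_bounds].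
Qed.
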